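(* Unweighted APSD enumeration can be solved (without preprocessing) with delay in $O(\overline{\Delta})$ and with space complexity in $\Theta(n)$.
   Context: Input: a directed or undirected unweighted graph $G=(V,E)$, $V=\{1,\dots,n\}$, $|E|=m$. $\overline{\Delta}$ denotes the average (out-)degree. $d(u,v)$ is the hop distance from $u$ to $v$, $\infty$ if unreachable, $d(u,u)=0$. APSD enumeration: output, for each ordered pair $u,v\in V$, the triple $(u,v,d(u,v))$ exactly once, one by one. Delay in $O(f)$: the time to the first output, between any two consecutive outputs, and after the last output until termination is signalled, are each $O(f)$. Model: word RAM with word size $\Omega(\log n)$; the graph is given as read-only adjacency lists with constant-time access to $n$ and to the degree of each vertex.
   Formalization: The delay is bounded by a constant times max(1, average degree) instead of the average degree itself, because every output takes at least one step and the literal bound fails for graphs whose average degree is zero or tends to zero. *)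

(* Defs.v *)
From mathcomp Require Import all_boot all_order all_algebra.
Set Implicit Arguments.
Unset Strict Implicit.
Unset Printing Implicit Defensive.

(** * Graphs

    A graph on n vertices is a relation on 'I_n; vertices are numbered from 0.
    An undirected graph is a symmetric relation: each edge is stored in the
    adjacency lists of both end points, so that the out-degree of a vertex is
    its degree. *)

Section HopDistance.
Variables (T : finType) (e : rel T).

Definition walk (k : nat) (u v : T) : bool :=
  [exists p : k.-tuple T, path e u p && (last u p == v)].

Lemma connect_walk u v : connect e u v -> exists k, walk k u v.
Proof.
case/connectP=> p ep ->; exists (size p); apply/existsP; exists (in_tuple p).
by rewrite ep eqxx.
Qed.

(* None stands for an infinite distance. *)
Definition hop_dist (u v : T) : option nat :=
  if @idP (connect e u v) is ReflectT uv
  then Some (ex_minn (connect_walk uv)) else None.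

End HopDistance.

Definition avg_outdeg n (e : rel 'I_n) : rat :=
  ((\sum_(u < n) #|e u|)%N%:R / n%:R)%R.

Definition triple : Type := nat * nat * option nat.

Definition apsd n (e : rel 'I_n) : seq triple :=
  [seq (val u, val v, hop_dist e u v) | u <- enum 'I_n, v <- enum 'I_n].

(** * Word RAM

    Words are the naturals below 2 ^ w.  A machine has registers (finitely
    many of which occur in a given program), a random access working memory
    and a read-only input memory, both addressed by words.  Each instruction
    takes one unit of time. *)

Inductive binop : Type :=
  | OpAdd | OpSub | OpMul | OpDiv | OpMod | OpAnd | OpOr | OpXor
  | OpShl | OpShr | OpEq | OpLt.

Definition eval_binop (w : nat) (o : binop) (x y : nat) : nat :=
  match o with
  | OpAdd => (x + y) %% 2 ^ w
  | OpSub => (x + 2 ^ w - y) %% 2 ^ w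
  | OpMul => (x * y) %% 2 ^ w
  | OpDiv => x %/ y
  | OpMod => x %% y
  | OpAnd => Nat.land x y
  | OpOr => Nat.lor x y
  | OpXor => Nat.lxor x y
  | OpShl => (x * 2 ^ y) %% 2 ^ w
  | OpShr => x %/ 2 ^ y
  | OpEq => x == y
  | OpLt => x < y
  end.

(* Arguments are register numbers, except for the constant k of Const and the
   program positions l of Jmp and Jz (jump if the register is zero). *)
Inductive instr : Type :=
  | Const (d k : nat)
  | Bin (o : binop) (d x y : nat)
  | LoadRam (d a : nat)
  | StoreRam (a s : nat)
  | LoadInput (d a : nat)
  | Jmp (l : nat)
  | Jz (x l : nat)
  | OutDist (u v d : nat)
  | OutInf (u v : nat)
  | Halt.

Definition program : Type := seq instr.

Record config : Type :=
  Config { pc : nat; reg : nat -> nat; ram : nat -> nat }.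

Definition cur_instr (p : program) (c : config) : instr := nth Halt p (pc c).

Definition halted (p : program) (c : config) : bool :=
  if cur_instr p c is Halt then true else false.

Definition step (w : nat) (rom : nat -> nat) (p : program) (c : config) :
    config :=
  let: Config i r m := c in
  match cur_instr p c with
  | Const d k => Config i.+1 [eta r with d |-> k %% 2 ^ w] m
  | Bin o d x y => Config i.+1 [eta r with d |-> eval_binop w o (r x) (r y)] m
  | LoadRam d a => Config i.+1 [eta r with d |-> m (r a)] m
  | StoreRam a s => Config i.+1 r [eta m with r a |-> r s]
  | LoadInput d a => Config i.+1 [eta r with d |-> rom (r a)] m
  | Jmp l => Config l r m
  | Jz x l => Config (if r x == 0 then l else i.+1) r m
  | OutDist _ _ _ | OutInf _ _ => Config i.+1 r m
  | Halt => c
  end.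

Definition emitted (p : program) (c : config) : option triple :=
  match cur_instr p c with
  | OutDist u v d => Some (reg c u, reg c v, Some (reg c d))
  | OutInf u v => Some (reg c u, reg c v, None)
  | _ => None
  end.

Definition accessed (p : program) (c : config) : seq nat :=
  match cur_instr p c with
  | LoadRam _ a | StoreRam a _ => [:: reg c a]
  | _ => [::]
  end.

Section Run.
Variables (w : nat) (rom ram0 : nat -> nat) (p : program).

Definition config_at (t : nat) : config :=
  iter t (step w rom p) (Config 0 (fun=> 0) ram0).

(* In the sequel T is a time at which the machine has halted. *)
Definition outputs (T : nat) : seq triple :=
  pmap (fun t => emitted p (config_at t)) (iota 0 T).

(* The instruction executed from config_at t is completed at time t.+1. *)
Definition output_times (T : nat) : seq nat :=
  [seq t.+1 | t <- iota 0 T & isSome (emitted p (config_at t))].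

(* Time until the first output, between consecutive outputs, and from the last
   output until termination. *)
Definition delays (T : nat) : seq nat :=
  pairmap (fun s t => t - s) 0 (rcons (output_times T) T).

(* Number of distinct words of working memory that are read or written; the
   registers, whose number depends only on the program, are not counted. *)
Definition space_used (T : nat) : nat :=
  size (undup (flatten [seq accessed p (config_at t) | t <- iota 0 T])).

End Run.

Definition word_valued (w : nat) (mem : nat -> nat) : Prop :=
  forall a, mem a < 2 ^ w.

(* A linked list of two-word cells (item, address of the next cell); address 0
   is the null pointer. *)
Fixpoint linked_list (w : nat) (rom : nat -> nat) (a : nat) (s : seq nat) :
    Prop :=
  if s is v :: s' then
    [/\ 0 < a, a.+1 < 2 ^ w, rom a = v & linked_list w rom (rom a.+1) s']
  else a = 0.

(* The neighbours of a vertex are listed once each, in any order, and the list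
   cells may be placed anywhere. *)
Definition adjacency_lists (w : nat) (rom : nat -> nat) n (e : rel 'I_n) :
    Prop :=
  rom 0 = n /\
  forall u : 'I_n, exists s : seq 'I_n,
    [/\ uniq s, s =i e u, rom (1 + u) = size s
      & linked_list w rom (rom (1 + n + u)) (map val s)].

(* Main.v *)
Require Import Defs.
From mathcomp Require Import all_boot all_order all_algebra.
From mathcomp Require Import zify.
Set Implicit Arguments.
Unset Strict Implicit.
Unset Printing Implicit Defensive.
Import Order.TTheory GRing.Theory Num.Theory.

(** A BFS from one source takes O(n + m) unit operations, so running it in n
    slots of q = m / n + 2 units each suffices.  In pass s (0 <= s <= n) the
    machine runs the BFS of source s and uses the n slots to output, one triple
    per slot, the distances from source s - 1, which the previous pass left in a
    second array; that array is erased on the way.  The only outputs available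
    during pass 0, and while m is computed, are the trivial triples (u, u, 0):
    those with u even are spent on the computation of m, those with u odd on
    pass 0, and pass s > 0 skips the slot s - 1.  At most two consecutive slots
    are silent. *)

(** * Breadth-first search *)

Section Walks.
Variables (T : finType) (e : rel T).

Lemma walkP k u v :
  reflect (exists p, [/\ path e u p, last u p = v & size p = k]) (walk e k u v).
Proof.
apply: (iffP existsP) => [[p /andP[ep /eqP pv]]|[p [ep pv pk]]].
  by exists p; rewrite size_tuple.
by exists (Tuple (introT eqP pk)); rewrite ep pv eqxx.
Qed.

Lemma walkSr k u v w : walk e k u v -> e v w -> walk e k.+1 u w.
Proof.
move=> /walkP[p [ep pv pk]] vw; apply/walkP; exists (rcons p w).
by rewrite rcons_path ep pv vw last_rcons size_rcons pk.
Qed.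

Lemma walk_connect k u v : walk e k u v -> connect e u v.
Proof. by case/walkP=> p [ep <- _]; apply/connectP; exists p. Qed.

Lemma hop_distP u v (d : nat) :
    (0 < d -> walk e d.-1 u v) ->
    (forall k, walk e k u v -> 0 < d <= k.+1) ->
  d = if hop_dist e u v is Some k then k.+1 else 0.
Proof.
move=> dwalk dmin; rewrite /hop_dist.
(* [hop_dist] matches on the proof carried by [idP], so the case analysis is made for an arbitrary
   [reflect] proof. *)
suff gen b (r : reflect (connect e u v) b) :
    d = if (if r is ReflectT uv then Some (ex_minn (connect_walk uv)) else None)
          is Some k then k.+1 else 0 by apply: gen.
case: r => [uv|nuv].
  case: ex_minnP => k /dmin/andP[d_gt0 le_dk] kmin.
  by have := kmin _ (dwalk d_gt0); lia.
by case: d dwalk {dmin} => // d /(_ isT)/walk_connect.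
Qed.

End Walks.

Section Bfs.
Variables (T : finType) (adj : T -> seq T).

(* label v is 0 if v is undiscovered, and the distance to the source plus one
   otherwise; todo lists the neighbours of the current vertex that remain to be
   scanned, and level is the label of that vertex (0 if there is none yet). *)
Record bfs := Bfs {
  label : T -> nat;
  visited : seq T;
  queue : seq T;
  todo : seq T;
  level : nat }.

Definition bfs_idle := Bfs (fun=> 0) [::] [::] [::] 0.

Definition bfs_init s := Bfs [eta fun=> 0 with s |-> 1] [::] [:: s] [::] 0.

Definition bfs_step st :=
  let: Bfs lab dn qu td lv := st in
  if td is w :: td' then
    if lab w == 0 then Bfs [eta lab with w |-> lv.+1] dn (rcons qu w) td' lv
    else Bfs lab dn qu td' lv
  else if qu is u :: qu' then Bfs lab (rcons dn u) qu' (adj u) (lab u)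
  else st.

(** The third and fourth clauses confine the labels in the queue, in nondecreasing order, to [level]
    and its successor. The last one bounds every label by the number of vertices plus one, so that
    labels fit in words. *)
Definition bfs_wf st :=
  [/\ uniq (visited st ++ queue st),
      forall v, (v \in visited st ++ queue st) = (0 < label st v),
      path leq (level st) (map (label st) (queue st)),
      forall v, label st v <= (level st).+1
    & level st <= size (visited st)].

Lemma bfs_idle_wf : bfs_wf bfs_idle.
Proof. by split. Qed.

Lemma bfs_init_wf s : bfs_wf (bfs_init s).
Proof.
split=> //= [v|v]; last by case: eqP.
by rewrite inE; case: eqP.
Qed.

Lemma bfs_step_wf st : bfs_wf st -> bfs_wf (bfs_step st).
Proof.
case: st => lab dn qu [|w td] lv [/= Huniq Hmem Hpath Hle Hlv].
  case: qu => [|u qu] //= in Huniq Hmem Hpath *.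
  have [lv_u pu] := andP Hpath.
  split=> //=; rewrite ?cat_rcons // ?size_rcons.
    by move=> v; apply: leq_trans (Hle v) _.
  by apply: leq_trans (Hle u) _.
case: eqP => [lab_w|_] /=; last by split.
have wN : w \notin dn ++ qu by rewrite Hmem lab_w.
split=> //=.
- by rewrite -rcons_cat rcons_uniq wN.
- move=> v; rewrite -rcons_cat mem_rcons inE Hmem.
  by case: eqP => //= ->.
- rewrite map_rcons /= eqxx rcons_path.
  have -> : map [eta lab with w |-> lv.+1] qu = map lab qu.
    apply/eq_in_map => x xq /=; case: eqP => // xw; case/negP: wN.
    by rewrite mem_cat -xw xq orbT.
  rewrite Hpath /=; have := mem_last lv (map lab qu).
  by rewrite inE => /predU1P[->|/mapP[y _ ->]].
- by move=> v; case: eqP.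
Qed.

Definition finished st := (todo st == [::]) && (queue st == [::]).

Lemma bfs_step_finished st : finished st -> bfs_step st = st.
Proof. by case: st => lab dn [|? ?] [|? ?] lv. Qed.

(** A potential that every unfinished step lowers by exactly one: an unvisited vertex is charged for
    its removal from the queue and for the scan of its list. *)
Definition work st :=
  size (todo st) + \sum_(v | v \notin visited st) (size (adj v)).+1.

Lemma bfs_step_work st :
  bfs_wf st -> ~~ finished st -> work st = (work (bfs_step st)).+1.
Proof.
case: st => lab dn qu [|w td] lv [/= Huniq _ _ _ _]; last first.
  by rewrite /work /= => _; case: eqP.
case: qu Huniq => [|u qu] //= Huniq _; rewrite /work /= add0n.
have uN : u \notin dn.
  move: Huniq; rewrite cat_uniq => /and3P[_ /hasPn/(_ u)].
  by rewrite mem_head => /(_ isT).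
rewrite (bigD1 u) //= addSn; congr (_ + _).+1; apply: eq_bigl => v.
by rewrite mem_rcons inE negb_or andbC.
Qed.

Lemma iter_bfs_wf k st : bfs_wf st -> bfs_wf (iter k bfs_step st).
Proof. by move=> wf; elim: k => //= k; apply: bfs_step_wf. Qed.

Lemma iter_bfs_finished k st :
  bfs_wf st -> work st <= k -> finished (iter k bfs_step st).
Proof.
elim: k st => [|k IHk] st wf; last first.
  have [fin _|nfin] := boolP (finished st).
    suff -> : iter k.+1 bfs_step st = st by [].
    by elim: k.+1 => //= j ->; apply: bfs_step_finished.
  rewrite (bfs_step_work wf nfin) ltnS iterSr; apply: IHk.
  exact: bfs_step_wf.
move=> le0; apply/negPn/negP => /(bfs_step_work wf) E.
by rewrite E in le0.
Qed.

(** * Final labels are hop distances *)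

Section Correct.
Variables (e : rel T) (s : T).
Hypothesis adjE : forall u v, (v \in adj u) = e u v.

(** In the last clause, [level st <= label st u] ensures that the label [(level st).+1], which [v]
    receives if it is still undiscovered when scanned, exceeds that of [u] by at most one. *)
Definition bfs_inv st :=
  [/\ label st s = 1,
      forall v, 0 < label st v -> walk e (label st v).-1 s v,
      forall v, v \in todo st -> walk e (level st) s v
    & forall u v, u \in visited st -> e u v ->
        (v \in todo st) && (level st <= label st u) ||
        (0 < label st v <= (label st u).+1)].

Lemma bfs_init_inv : bfs_inv (bfs_init s).
Proof.
split=> //= [|v]; first by rewrite eqxx.
case: eqP => // -> _; apply/walkP; by exists [::].
Qed.

Lemma bfs_step_inv st : bfs_wf st -> bfs_inv st -> bfs_inv (bfs_step st).
Proof.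
case: st => lab dn qu td lv [/= _ Hmem Hpath Hle _] [/= Hs Hwalk Htd Hdn].
case: td Htd Hdn => [|w td] Htd Hdn.
  case: qu Hmem Hpath => [|u qu] //= Hmem _.
  have lab_u : 0 < lab u by rewrite -Hmem mem_cat mem_head orbT.
  split=> //= [v|x v].
    rewrite adjE => uv; rewrite -(prednK lab_u); apply: walkSr uv.
    exact: Hwalk.
  rewrite mem_rcons inE => /predU1P[-> uv|xd xv].
    by rewrite adjE uv leqnn.
  by have /= -> := Hdn x v xd xv; rewrite orbT.
have sw : lab w == 0 -> s == w = false.
  by move=> /eqP lw; apply/eqP => sw; rewrite -sw Hs in lw.
case: eqP => [/eqP lab_w|/eqP lab_w] /=; split=> //=.
- by rewrite sw.
- move=> v; case: eqP => [->|_ /Hwalk//] _ /=.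
  by apply: Htd; rewrite mem_head.
- by move=> v vt; apply: Htd; rewrite inE vt orbT.
- move=> u v ud uv.
  have /negPf-> : u != w.
    by apply: contraTneq lab_w => <-; rewrite -lt0n -Hmem mem_cat ud.
  have := Hdn u v ud uv; rewrite inE.
  case: (v =P w) => [->|_] //=.
  by rewrite (eqP lab_w) orbF ltnS => ->; rewrite orbT.
- by move=> v vt; apply: Htd; rewrite inE vt orbT.
- move=> u v ud uv; have := Hdn u v ud uv; rewrite inE.
  case: (v =P w) => [->|_] //= /orP[le_lv|->]; last by rewrite orbT.
  by rewrite lt0n lab_w (leq_trans (Hle w)) ?orbT.
Qed.

Lemma bfs_inv_finished st v : bfs_wf st -> bfs_inv st -> finished st ->
  label st v = if hop_dist e s v is Some k then k.+1 else 0.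
Proof.
case: st => lab dn qu td lv [/= _ Hmem _ _ _] [/= Hs Hwalk _ Hdn].
case/andP=> /= /eqP td0 /eqP qu0; apply: hop_distP; first exact: Hwalk.
(* With an empty queue every labelled vertex is visited, so labels grow by at most one along each
   edge of a walk. *)
move=> k /walkP[p [ep <- <-]]; elim/last_ind: p ep => [|p x IHp] /=.
  by rewrite Hs.
rewrite rcons_path last_rcons size_rcons => /andP[/IHp/andP[lab_gt0 lab_le]].
move=> /(Hdn (last s p) x); rewrite td0 /= -[dn]cats0 -qu0 Hmem lab_gt0.
by move=> /(_ isT)/andP[-> /leq_trans]; apply.
Qed.

Lemma bfs_final k v : \sum_u (size (adj u)).+1 <= k ->
  label (iter k bfs_step (bfs_init s)) v =
  if hop_dist e s v is Some d then d.+1 else 0.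
Proof.
move=> le_k; have wf0 := bfs_init_wf s.
apply: bfs_inv_finished; first exact: iter_bfs_wf.
  elim: k {le_k} => [|k IHk] /=; first exact: bfs_init_inv.
  by apply: bfs_step_inv IHk; apply: iter_bfs_wf.
by apply: iter_bfs_finished.
Qed.

End Correct.
End Bfs.

(** * Symbolic execution *)

Section Reach.
Variables (w : nat) (rom : nat -> nat) (p : program).
Variables (B M : nat) (P : seq triple -> Prop).

Local Notation "rs `[ i ]" := (nth 0 rs i) (at level 2, format "rs `[ i ]").

(* reach i rs m g o nd: the machine halts from program position i, register
   contents rs (padded with zeros) and memory m, never takes more than B steps
   without an output, only accesses addresses below M, and its total output
   satisfies P, given that o has been output already and that the last output
   was g steps ago.  Every address in nd is accessed before halting. *)
Inductive reach :
    nat -> seq nat -> (nat -> nat) -> nat -> seq triple -> seq nat -> Prop :=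
| reach_halt i rs m g o :
    nth Halt p i = Halt -> g <= B -> P o -> reach i rs m g o [::]
| reach_const i rs m g o nd d k :
    nth Halt p i = Const d k -> g < B -> k < 2 ^ w ->
    reach i.+1 (set_nth 0 rs d k) m g.+1 o nd ->
    reach i rs m g o nd
| reach_bin i rs m g o nd b d x y z :
    nth Halt p i = Bin b d x y -> g < B ->
    eval_binop w b rs`[x] rs`[y] = z ->
    reach i.+1 (set_nth 0 rs d z) m g.+1 o nd ->
    reach i rs m g o nd
| reach_load i rs m g o nd d a :
    nth Halt p i = LoadRam d a -> g < B -> rs`[a] < M ->
    reach i.+1 (set_nth 0 rs d (m rs`[a])) m g.+1 o nd ->
    reach i rs m g o nd
| reach_store i rs m g o nd a s :
    nth Halt p i = StoreRam a s -> g < B -> rs`[a] < M ->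
    reach i.+1 rs [eta m with rs`[a] |-> rs`[s]] g.+1 o (rem rs`[a] nd) ->
    reach i rs m g o nd
| reach_input i rs m g o nd d a z :
    nth Halt p i = LoadInput d a -> g < B -> rom rs`[a] = z ->
    reach i.+1 (set_nth 0 rs d z) m g.+1 o nd ->
    reach i rs m g o nd
| reach_jmp i rs m g o nd l :
    nth Halt p i = Jmp l -> g < B ->
    reach l rs m g.+1 o nd ->
    reach i rs m g o nd
| reach_jz i rs m g o nd x l :
    nth Halt p i = Jz x l -> g < B ->
    reach (if rs`[x] == 0 then l else i.+1) rs m g.+1 o nd ->
    reach i rs m g o nd
| reach_outdist i rs m g o nd u v d :
    nth Halt p i = OutDist u v d -> g < B ->
    reach i.+1 rs m 0 (rcons o (rs`[u], rs`[v], Some rs`[d])) nd ->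
    reach i rs m g o nd
| reach_outinf i rs m g o nd u v :
    nth Halt p i = OutInf u v -> g < B ->
    reach i.+1 rs m 0 (rcons o (rs`[u], rs`[v], None)) nd ->
    reach i rs m g o nd.

Variables (ram0 : nat -> nat) (need : seq nat).
Local Notation cfg := (config_at w rom ram0 p).
Local Notation outs := (outputs w rom ram0 p).
Local Notation times := (output_times w rom ram0 p).

Definition addresses T := flatten [seq accessed p (cfg t) | t <- iota 0 T].

(** Ties the actual run up to time [T] to the arguments of [reach]. Registers are compared
    pointwise, against a list padded with zeros. *)
Record traced (T i : nat) (rs : seq nat) (m : nat -> nat) (g : nat)
    (o : seq triple) (nd : seq nat) : Prop := Traced {
  traced_pc : pc (cfg T) = i;
  traced_reg : reg (cfg T) =1 nth 0 rs;
  traced_ram : ram (cfg T) = m;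
  traced_outs : outs T = o;
  traced_gap : g + last 0 (times T) = T;
  traced_delays : {in pairmap (fun s t => t - s) 0 (times T), forall t, t <= B};
  traced_addr : {in addresses T, forall a, a < M};
  traced_need : {subset need <= addresses T ++ nd} }.

Lemma traced_step T i rs m g o nd g' o' nd' i' rs' m' :
  traced T i rs m g o nd -> g < B ->
  (forall r, r =1 nth 0 rs -> let c := Config i r m in
   [/\ if emitted p c is Some x then g' = 0 /\ o' = rcons o x
        else g' = g.+1 /\ o' = o,
       {in accessed p c, forall a, a < M},
       {subset nd <= accessed p c ++ nd'} &
       let c' := step w rom p c in
       [/\ pc c' = i', reg c' =1 nth 0 rs' & ram c' = m']]) ->
  traced T.+1 i' rs' m' g' o' nd'.
Proof.
move=> [Epc Ereg Eram Eout Egap Edel Eaddr Eneed] gB /(_ _ Ereg).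
rewrite -{}Epc -{}Eram.
have -> : Config (pc (cfg T)) (reg (cfg T)) (ram (cfg T)) = cfg T.
  by case: (cfg T).
case=> [Eem Hacc Hnd [pc' reg' ram']].
have iotaS : iota 0 T.+1 = iota 0 T ++ [:: T] by rewrite -addn1 iotaD.
have timesS : times T.+1 =
    times T ++ (if emitted p (cfg T) is Some _ then [:: T.+1] else [::]).
  rewrite /output_times iotaS filter_cat map_cat /=.
  by case: (emitted p (cfg T)).
have addrS : addresses T.+1 = addresses T ++ accessed p (cfg T).
  by rewrite /addresses iotaS map_cat flatten_cat /= cats0.
split; [exact: pc' | exact: reg' | exact: ram' | idtac ..].
- rewrite /outputs iotaS pmap_cat [pmap _ (iota 0 T)]Eout /=.
  by case: (emitted p (cfg T)) Eem => [x|] [_ ->]; rewrite ?cats1 ?cats0.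
- rewrite timesS; case: (emitted p (cfg T)) Eem => [x|] [-> _].
    by rewrite cats1 last_rcons.
  by rewrite cats0 addSn Egap.
- move=> t; rewrite timesS pairmap_cat mem_cat => /orP[/Edel//|].
  by case: (emitted p (cfg T)) => [x|] //=; rewrite inE => /eqP->; lia.
- by move=> a; rewrite addrS mem_cat => /orP[/Eaddr|/Hacc].
- move=> a /Eneed; rewrite addrS -catA !mem_cat => /orP[->//|/Hnd].
  by rewrite mem_cat => ->; rewrite orbT.
Qed.

Definition terminates :=
  exists T, [/\ halted p (cfg T), P (outs T),
    {in delays w rom ram0 p T, forall t, t <= B},
    {in addresses T, forall a, a < M}
  & {subset need <= addresses T}].

(** Each constructor but the first is one machine step, so induction on the finite derivation of
    [reach] yields the halting time. *)
Lemma traced_terminates T i rs m g o nd :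
  reach i rs m g o nd -> traced T i rs m g o nd -> terminates.
Proof.
move=> H; elim: H T => {i rs m g o nd}.
- move=> i rs m g o Ei gB Po T [Epc _ _ Eo Eg Ed Ea En]; exists T; split=> //.
  + by rewrite /halted /cur_instr Epc Ei.
  + by rewrite Eo.
  + move=> t; rewrite /delays -cats1 pairmap_cat mem_cat => /orP[/Ed//|] /=.
    by rewrite inE => /eqP->; lia.
  + by move=> a /En; rewrite cats0.
all: move=> i rs m g o nd; intros;
  match goal with H : traced _ _ _ _ _ _ _ |- _ => rename H into tr end;
  match goal with H : nth Halt p _ = _ |- _ => rename H into Ei end;
  match goal with IH : forall T, traced T _ _ _ _ _ _ -> _ |- _ =>
   apply: (IH _) end;
  apply: (traced_step tr) => // r Er;
  rewrite /step /emitted /accessed /cur_instr /= Ei ?Er;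
  split=> //=; try split => //=.
- by move=> j; rewrite nth_set_nth /= modn_small // Er.
- match goal with H : eval_binop _ _ _ _ = _ |- _ => rewrite H end.
  by move=> j; rewrite nth_set_nth /= Er.
- by move=> x; rewrite inE => /eqP->.
- by move=> x; rewrite inE orbC => ->.
- by move=> j; rewrite nth_set_nth /= Er.
- by move=> x; rewrite inE => /eqP->.
- move=> x x_nd; have [a_nd|a_nd] := boolP (rs`[a] \in nd).
    by rewrite -(perm_mem (perm_to_rem a_nd)).
  by rewrite rem_id // inE x_nd orbT.
- match goal with H : rom _ = _ |- _ => rewrite H end.
  by move=> j; rewrite nth_set_nth /= Er.
Qed.

Lemma reach_terminates k : reach 0 (nseq k 0) ram0 0 [::] need -> terminates.
Proof.
move=> r0; apply: (traced_terminates (T := 0) r0); split=> //.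
by move=> x; rewrite nth_nseq if_same.
Qed.

Lemma reach_add i rs m g o nd d x y :
  nth Halt p i = Bin OpAdd d x y -> g < B -> rs`[x] + rs`[y] < 2 ^ w ->
  reach i.+1 (set_nth 0 rs d (rs`[x] + rs`[y])) m g.+1 o nd ->
  reach i rs m g o nd.
Proof. by move=> Ei gB small; apply: reach_bin Ei gB _; apply: modn_small. Qed.

Lemma reach_sub i rs m g o nd d x y :
  nth Halt p i = Bin OpSub d x y -> g < B -> rs`[y] <= rs`[x] < 2 ^ w ->
  reach i.+1 (set_nth 0 rs d (rs`[x] - rs`[y])) m g.+1 o nd ->
  reach i rs m g o nd.
Proof.
move=> Ei gB /andP[le_yx small]; apply: reach_bin Ei gB _ => /=.
by rewrite -addnBAC // modnDr modn_small // (leq_ltn_trans (leq_subr _ _)).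
Qed.

End Reach.

(** * The program *)

(* Registers: 0 = zero, 1 = one, 2 = n, 3 = q (first the partial sums of m),
   4 = array written by the current BFS, 5 = array of the previous one,
   6 = start of the queue, 7 = pass, 8 = slot, 9 = units left in the slot,
   10 = adjacency cell to be scanned, 11 = level, 12 = head and 13 = tail of the
   queue, 14 to 16 = temporaries.  The two arrays occupy the addresses 0 to
   2n - 1 and the queue those from 2n to 3n - 1.  The comments give program
   positions. *)
Definition prog : program := [::
  (*  0 *) Const 1 1; LoadInput 2 0;
  (*  2 *) Bin OpLt 14 8 2; Jz 14 15; Bin OpAdd 14 8 1; LoadInput 15 14;
           Bin OpAdd 3 3 15; StoreRam 8 0; Const 15 2; Bin OpMod 15 8 15;
           Jz 15 12; Jmp 13; OutDist 8 8 0; Bin OpAdd 8 8 1; Jmp 2;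
  (* 15 *) Bin OpDiv 3 3 2; Bin OpAdd 3 3 1; Bin OpAdd 3 3 1; Bin OpAdd 5 2 0;
           Bin OpAdd 6 2 2;
  (* 20 *) Bin OpAdd 12 6 0; Bin OpAdd 13 6 0; Const 10 0; Const 11 0;
           Bin OpLt 14 7 2; Jz 14 30; Bin OpAdd 14 4 7; StoreRam 14 1;
           StoreRam 13 7; Bin OpAdd 13 13 1; Const 8 0;
  (* 31 *) Bin OpLt 14 8 2; Jz 14 80; Bin OpAdd 9 3 0;
  (* 34 *) Jz 9 59; Bin OpSub 9 9 1; Jz 10 49;
  (* 37 *) LoadInput 14 10; Bin OpAdd 15 10 1; LoadInput 10 15;
           Bin OpAdd 15 4 14; LoadRam 16 15; Jz 16 44; Jmp 34;
  (* 44 *) Bin OpAdd 16 11 1; StoreRam 15 16; StoreRam 13 14;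
           Bin OpAdd 13 13 1; Jmp 34;
  (* 49 *) Bin OpLt 14 12 13; Jz 14 34; LoadRam 14 12; Bin OpAdd 12 12 1;
           Bin OpAdd 15 4 14; LoadRam 11 15; Bin OpAdd 15 14 2;
           Bin OpAdd 15 15 1; LoadInput 10 15; Jmp 34;
  (* 59 *) Jz 7 72; Bin OpSub 14 7 1; Bin OpEq 15 14 8; Bin OpAdd 16 5 8;
           Jz 15 65; Jmp 77; LoadRam 15 16; Jz 15 70; Bin OpSub 15 15 1;
           OutDist 14 8 15; Jmp 77; OutInf 14 8; Jmp 77;
  (* 72 *) Const 15 2; Bin OpMod 15 8 15; Bin OpAdd 16 5 8; Jz 15 77;
           OutDist 8 8 0;
  (* 77 *) StoreRam 16 0; Bin OpAdd 8 8 1; Jmp 31;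
  (* 80 *) Bin OpEq 14 7 2; Jz 14 83; Halt; Bin OpAdd 7 7 1;
           Bin OpAdd 14 4 0; Bin OpAdd 4 5 0; Bin OpAdd 5 14 0; Jmp 20].

(** * Execution of the program, fragment by fragment *)

Section Machine.
Variables (n w : nat) (rom : nat -> nat) (adj : 'I_n -> seq 'I_n).
Variables (B : nat) (P : seq triple -> Prop).

Let m := \sum_(u < n) size (adj u).
Let q := m %/ n + 2.

Hypothesis n_gt0 : 0 < n.
Hypothesis small : 3 * n + m + 20 < 2 ^ w.
Hypothesis rom_n : rom 0 = n.
Hypothesis rom_deg : forall u : 'I_n, rom (1 + u) = size (adj u).
Hypothesis rom_adj : forall u : 'I_n,
  linked_list w rom (rom (1 + n + u)) (map val (adj u)).

Local Notation reach := (reach w rom prog B (3 * n) P).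

(** The two distance arrays swap roles after each pass. *)
Definition banks (cur prev : nat) : Prop :=
  (cur = 0 /\ prev = n) \/ (cur = n /\ prev = 0).

(** Of [visited] only the size is represented, by the position of the queue head: a vertex enters
    the queue at most once, so [n] cells suffice without wrap-around. *)
Record rep (cur : nat) (M : nat -> nat) (ptr d H T : nat) (st : bfs 'I_n) :
    Prop := Rep {
  rep_label : forall v : 'I_n, M (cur + v) = label st v;
  rep_queue : forall i, i < size (queue st) ->
    M (H + i) = nth 0 (map val (queue st)) i;
  rep_todo : linked_list w rom ptr (map val (todo st));
  rep_level : d = level st;
  rep_head : H = n + n + size (visited st);
  rep_tail : T = H + size (queue st) }.

Lemma bfs_wf_size (st : bfs 'I_n) : bfs_wf st ->
  size (visited st) + size (queue st) <= n.
Proof.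
case=> Huniq _ _ _ _; rewrite -size_cat -(card_uniqP Huniq).
by rewrite -[n in _ <= n]card_ord max_card.
Qed.

Ltac add :=
  apply: reach_add; [reflexivity | lia | rewrite /=; lia | rewrite /=].
Ltac sub :=
  apply: reach_sub; [reflexivity | lia | rewrite /=; lia | rewrite /=].
Ltac bin :=
  apply: reach_bin; [reflexivity | lia | reflexivity | rewrite /=].
Ltac const :=
  apply: reach_const; [reflexivity | lia | lia | rewrite /=].
Ltac load :=
  apply: reach_load; [reflexivity | lia | rewrite /=; lia | rewrite /=].
Ltac store :=
  apply: reach_store; [reflexivity | lia | rewrite /=; lia | rewrite /=].
Ltac input :=
  apply: reach_input; [reflexivity | lia | reflexivity | rewrite /=].
Ltac jmp := apply: reach_jmp; [reflexivity | lia | ].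
Ltac jz := apply: reach_jz; [reflexivity | lia | rewrite /=].

(* In continuation-passing style: the last premise is about the configurations
   in which the program fragment may end. *)
Lemma unit_step cur prev s v k ptr d H T t1 t2 t3 M g o st :
  banks cur prev -> k < q -> rep cur M ptr d H T st -> bfs_wf st ->
  g + 14 <= B ->
  (forall ptr' d' H' T' t1' t2' t3' M' g',
    rep cur M' ptr' d' H' T' (bfs_step adj st) -> g' <= g + 14 ->
    (forall x, x < n -> M' (prev + x) = M (prev + x)) ->
    reach 34 [:: 0; 1; n; q; cur; prev; n + n; s; v; k; ptr'; d'; H'; T';
                 t1'; t2'; t3'] M' g' o [::]) ->
  reach 34 [:: 0; 1; n; q; cur; prev; n + n; s; v; k.+1; ptr; d; H; T;
               t1; t2; t3] M g o [::].
Proof.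
move=> bk k_q [Rlab Rqueue Rtodo Rlev Rh Rt] wf gB K.
have le_qm : q <= m + 2 by rewrite /q leq_add2r leq_div.
have wf' := bfs_step_wf adj wf.
have sz := bfs_wf_size wf; have sz' := bfs_wf_size wf'.
jz; sub; rewrite subn1 /=.
case: st wf wf' sz sz' Rlab Rqueue Rtodo Rlev Rh Rt K => lab dn qu td lv /=.
move=> [/= _ _ _ Hle Hlv] wf' sz sz' Rlab Rqueue Rtodo Rlev Rh Rt.
rewrite /banks in bk.
case: td Rtodo wf' sz' => [|u td] /= Rtodo wf' sz' K.
  rewrite {}Rtodo in K *; jz.
  bin; jz.
  case: qu Rqueue Rt sz wf' sz' K => [|u qu] Rqueue Rt sz wf' sz' /= K;
    rewrite /= in Rt sz sz'.
    rewrite Rt addn0 ltnn /=; apply: (K _ _ _ _ _ _ _ M) => //; last by lia.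
    by split=> //=; lia.
  have -> : H < T by lia.
  have Mu : M H = u by have := Rqueue 0 isT; rewrite addn0.
  have := ltn_ord u => u_n.
  load; rewrite Mu; add; add; load; rewrite Rlab; add; add; input; jmp.
  apply: (K _ _ _ _ _ _ _ M) => //; last by lia.
  split=> //=.
  - by move=> i i_qu; rewrite addn1 addSnnS Rqueue.
  - by have -> : u + n + 1 = 1 + n + u by lia; apply: rom_adj.
  - by rewrite size_rcons; lia.
  - by lia.
have u_n := ltn_ord u.
case: Rtodo => ptr_gt0 ptr_small rom_ptr Rtodo.
jz; rewrite -{1}(prednK ptr_gt0) /=.
input; rewrite rom_ptr; add; input; add; load; rewrite Rlab.
jz; case: eqP wf' sz' K => [lab_u|lab_u] wf' sz' K; last first.
  jmp; apply: (K _ _ _ _ _ _ _ M) => //; last by lia.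
  by split=> //=; rewrite addn1.
(* Well-formedness after the step provides a free queue cell, so [T] is below [3 * n]. This branch
   is the longest: 14 instructions. *)
rewrite /= size_rcons in sz'.
add; store; store; add; jmp.
apply: (K _ _ _ _ _ _ _ _ _ _) => //; [|lia|].
  split=> //=.
  - move=> v'; have v'_n := ltn_ord v'; case: eqP => [|_]; first by lia.
    by rewrite eqn_add2l val_eqE; case: eqP => // _; lia.
  - rewrite size_rcons map_rcons => i.
    rewrite nth_rcons size_map ltnS leq_eqVlt.
    case/predU1P => [->|i_qu]; first by rewrite -Rt !eqxx ltnn.
    rewrite i_qu {1}Rt eqn_add2l ltn_eqF //.
    by case: (H + i =P cur + u) => [|_]; [lia|apply: Rqueue].
  - by rewrite addn1.
  - by rewrite size_rcons; lia.
move=> x x_n /=; case: (prev + x =P T) => [|_]; first by lia.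
by case: (prev + x =P cur + u) => [|_]; first by lia.
Qed.

Lemma units_run cur prev s v k ptr d H T t1 t2 t3 M g o st :
  banks cur prev -> k <= q -> rep cur M ptr d H T st -> bfs_wf st ->
  g + 14 * k < B ->
  (forall ptr' d' H' T' t1' t2' t3' M' g',
    rep cur M' ptr' d' H' T' (iter k (bfs_step adj) st) ->
    g' <= (g + 14 * k).+1 ->
    (forall x, x < n -> M' (prev + x) = M (prev + x)) ->
    reach 59 [:: 0; 1; n; q; cur; prev; n + n; s; v; 0; ptr'; d'; H'; T';
                 t1'; t2'; t3'] M' g' o [::]) ->
  reach 34 [:: 0; 1; n; q; cur; prev; n + n; s; v; k; ptr; d; H; T;
               t1; t2; t3] M g o [::].
Proof.
move=> bk; elim: k ptr d H T t1 t2 t3 M g st =>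
    [|k IHk] ptr d H T t1 t2 t3 M g st kq R wf gB K.
  by jz; apply: K => //; lia.
apply: (unit_step _ _ _ bk kq R wf); first by lia.
move=> ptr' d' H' T' t1' t2' t3' M' g' R' g'_le M'prev.
apply: (IHk _ _ _ _ _ _ _ _ _ _ (ltnW kq) R' (bfs_step_wf adj wf)).
  by lia.
move=> ptr2 d2 H2 T2 t12 t22 t32 M2 g2 R2 g2_le M2prev.
apply: K; rewrite ?iterSr //; first by lia.
by move=> x x_n; rewrite M2prev // M'prev.
Qed.

(** * Output slots and passes *)

Variable dst : nat -> nat -> option nat.

Definition code (d : option nat) := if d is Some k then k.+1 else 0.

Definition slot_out s v : seq triple :=
  if s is s'.+1 then if v == s' then [::] else [:: (s', v, dst s' v)]
  else if odd v then [:: (v, v, Some 0)] else [::].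

(** The cell read is erased in every case, also in pass 0, so that the array is blank when the next
    search writes to it. *)
Lemma emit_run cur prev s v ptr d H T t1 t2 t3 M g o :
  banks cur prev -> v < n -> s <= n -> g + 13 <= B ->
  (0 < s -> M (prev + v) = code (dst s.-1 v)) ->
  code (dst s.-1 v) <= n.+1 ->
  (forall t1' t2' t3' g', g' <= (if slot_out s v is [::] then g + 13 else 5) ->
    reach 31 [:: 0; 1; n; q; cur; prev; n + n; s; v.+1; 0; ptr; d; H; T;
                 t1'; t2'; t3'] [eta M with prev + v |-> 0] g'
          (o ++ slot_out s v) [::]) ->
  reach 59 [:: 0; 1; n; q; cur; prev; n + n; s; v; 0; ptr; d; H; T;
               t1; t2; t3] M g o [::].
Proof.
rewrite /banks => bk v_n s_n gB Mv code_le K; jz.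
case: s s_n Mv code_le K => [|s] s_n /= Mv code_le K.
  const; bin; add; rewrite modn2 in K *; jz.
  case: odd K => /= K.
    apply: reach_outdist; [reflexivity | lia | rewrite /=].
    by store; add; jmp; rewrite addn1 -cats1; apply: K; lia.
  by store; add; jmp; rewrite addn1 -[o]cats0; apply: K; lia.
sub; bin; add; rewrite subn1 /=; jz; rewrite eqb0 eq_sym in K *.
case: eqP K => [vs|vs] /= K.
  by jmp; store; add; jmp; rewrite addn1 -[o]cats0; apply: K; lia.
load; jz; rewrite {}Mv // in K *; case: (dst s v) code_le K => [d'|] /= d'_le K.
  sub; apply: reach_outdist; [reflexivity | lia | rewrite /= subn1 /=].
  by jmp; store; add; jmp; rewrite addn1 -cats1; apply: K; lia.
apply: reach_outinf; [reflexivity | lia | rewrite /=].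
by jmp; store; add; jmp; rewrite addn1 -cats1; apply: K; lia.
Qed.

(* In pass n there is no source left, and the BFS units do nothing. *)
Definition source s : bfs 'I_n :=
  oapp (@bfs_init 'I_n) (bfs_idle 'I_n) (insub s).

Lemma source_wf s : bfs_wf (source s).
Proof.
rewrite /source; case: insub => [s'|] /=; first exact: bfs_init_wf.
exact: bfs_idle_wf.
Qed.

Hypothesis dst_label : forall s v : 'I_n,
  label (iter (n * q) (bfs_step adj) (bfs_init s)) v = code (dst s v).

Lemma code_dst_le s v : s < n -> v < n -> code (dst s v) <= n.+1.
Proof.
move=> s_n v_n; rewrite -(dst_label (Ordinal s_n) (Ordinal v_n)).
have wf := iter_bfs_wf adj (n * q) (bfs_init_wf (Ordinal s_n)).
have sz := bfs_wf_size wf; case: wf => _ _ _ lab_le lev_le.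
apply: leq_trans (lab_le _) _; rewrite ltnS (leq_trans lev_le) //.
exact: leq_trans (leq_addr _ _) sz.
Qed.

(** The array being erased is disjoint from the array and the queue of the running search. *)
Lemma rep_store cur prev M ptr d H T st x :
  banks cur prev -> x < n -> rep cur M ptr d H T st ->
  rep cur [eta M with prev + x |-> 0] ptr d H T st.
Proof.
rewrite /banks => bk x_n [Rlab Rqueue Rtodo Rlev Rh Rt]; split=> //=.
  move=> v; have v_n := ltn_ord v.
  case: (cur + v =P prev + x) => [|_]; first by lia.
  exact: Rlab.
move=> i i_qu; case: (H + i =P prev + x) => [|_]; first by lia.
exact: Rqueue.
Qed.

Let E := 14 * q + 20.

(* Bounds the time since the last output at the beginning of slot v of pass s;
   E bounds the duration of a slot, in which each unit takes at most 14 steps.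
   The gap is longest after the slot s - 1, which is silent. *)
Definition slot_gap s v :=
  if s == 0 then 40 + odd v * E
  else 5 + (v == 0) * (E + 70) + (v == s) * (2 * E + 70).

Lemma slot_gap_le s v : slot_gap s v <= 2 * E + 75.
Proof.
rewrite /slot_gap; case: (s =P 0) => [_|s0]; first by case: odd => /=; lia.
by case: (v =P 0) => [v0|_]; case: (v =P s) => [vs|_] /=; lia.
Qed.

Hypothesis B_ge : 4 * E + 200 <= B.

Lemma slots_run s j v cur prev ptr d H T t1 t2 t3 k M g o :
  banks cur prev -> s <= n -> v + j = n ->
  rep cur M ptr d H T (iter (v * q) (bfs_step adj) (source s)) ->
  (forall x, x < v -> M (prev + x) = 0) ->
  (0 < s -> forall x, v <= x < n -> M (prev + x) = code (dst s.-1 x)) ->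
  g <= slot_gap s v ->
  (forall ptr' d' H' T' t1' t2' t3' k' M' g',
    rep cur M' ptr' d' H' T' (iter (n * q) (bfs_step adj) (source s)) ->
    (forall x, x < n -> M' (prev + x) = 0) -> g' <= slot_gap s n + 2 ->
    reach 80 [:: 0; 1; n; q; cur; prev; n + n; s; n; k'; ptr'; d'; H'; T';
                 t1'; t2'; t3'] M' g'
          (o ++ flatten [seq slot_out s x | x <- iota v j]) [::]) ->
  reach 31 [:: 0; 1; n; q; cur; prev; n + n; s; v; k; ptr; d; H; T;
               t1; t2; t3] M g o [::].
Proof.
move=> bk s_n.
have le_qm : q <= m + 2 by rewrite /q leq_add2r leq_div.
elim: j v ptr d H T t1 t2 t3 k M g o =>
    [|j IHj] v ptr d H T t1 t2 t3 k M g o vj R M0 Mdst g_le K.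
  have gB := leq_trans g_le (slot_gap_le s v).
  rewrite addn0 in vj; rewrite {}vj in M0 Mdst R g_le *.
  by bin; rewrite ltnn /=; jz; rewrite -[o]cats0; apply: K => //; lia.
have v_n : v < n by lia.
have gB := leq_trans g_le (slot_gap_le s v).
have wf := iter_bfs_wf adj (v * q) (source_wf s).
bin; rewrite v_n /=; jz; add; rewrite addn0.
apply: (units_run _ _ _ bk (leqnn q) R wf); first by lia.
move=> ptr1 d1 H1 T1 t11 t21 t31 M1 g1 R1 g1_le M1prev.
apply: (emit_run _ _ _ bk v_n s_n); first by lia.
- by move=> s_gt0; rewrite M1prev // Mdst // leqnn.
- by apply: code_dst_le => //; lia.
move=> t12 t22 t32 g2 g2_le; rewrite -iterD addnC -mulSnr in R1.
apply: (IHj v.+1); [by lia | exact: rep_store R1 | | | | ].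
- move=> x; rewrite ltnS leq_eqVlt => /predU1P[->|x_v] /=.
    by rewrite eqxx.
  by case: eqP => // _; rewrite M1prev ?M0 //; lia.
- move=> s_gt0 x /andP[v_x x_n] /=; rewrite eqn_add2l gtn_eqF //.
  by rewrite M1prev // Mdst // ltnW.
(* An output leaves a gap of at most 5; a silent slot adds at most [E], namely 3 steps of loop
   control, [14 * q + 1] for the units and 13 for the rest. *)
- move: g_le g2_le; rewrite /slot_gap /slot_out.
  case: (s) => [|s'] /=.
    by case: odd => /=; lia.
  rewrite eqSS; case: (v =P s') => [vs|vs] /= g_le g2_le.
    rewrite (_ : (v == s'.+1) = false) in g_le; last by lia.
    by case: (v =P 0) g_le => _ /=; lia.
  by case: (v =P 0) g_le => _ /=; case: (v =P s'.+1) => _ /=; lia.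
move=> ptr3 d3 H3 T3 t13 t23 t33 k3 M3 g3 R3 M30 g3_le.
by rewrite -catA; apply: K.
Qed.

Definition pass_out s := flatten [seq slot_out s v | v <- iota 0 n].

(** The array [cur] is blank at the start of a pass because the previous pass erased it, or, for
    pass 0, the loop that sums the degrees; no separate initialisation is needed. *)
Lemma passes_run j s cur prev v k ptr d H T t1 t2 t3 M g o :
  banks cur prev -> s + j = n ->
  (forall x, x < n -> M (cur + x) = 0) ->
  (0 < s -> forall x, x < n -> M (prev + x) = code (dst s.-1 x)) ->
  g <= (if s == 0 then 28 else E + 50) ->
  P (o ++ flatten [seq pass_out x | x <- iota s j.+1]) ->
  reach 20 [:: 0; 1; n; q; cur; prev; n + n; s; v; k; ptr; d; H; T;
               t1; t2; t3] M g o [::].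
Proof.
have le_qm : q <= m + 2 by rewrite /q leq_add2r leq_div.
elim: j s cur prev v k ptr d H T t1 t2 t3 M g o =>
    [|j IHj] s cur prev v k ptr d H T t1 t2 t3 M g o bk sj M0 Mdst g_le Po;
  have gB : g <= E + 50 by [case: ifP g_le => _; lia];
  have slot0 : g + 11 <= slot_gap s 0 by
    [rewrite /slot_gap; case: (s =P 0) g_le => _ /=; lia];
  have bk' := bk; rewrite /banks in bk'.
  rewrite addn0 in sj; rewrite {s}sj in M0 Mdst g_le slot0 Po *.
  add; add; const; const; bin; rewrite ltnn /=; jz; const; rewrite addn0.
  apply: (slots_run _ _ _ _ (j := n) bk (leqnn n)) => //; last 1 first.
  - move=> ptr1 d1 H1 T1 t11 t21 t31 k1 M1 g1 _ _ g1_le.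
    have g1B := leq_trans g1_le (leq_add (slot_gap_le n n) (leqnn 2)).
    bin; rewrite eqxx /=; jz; apply: reach_halt => //; first by lia.
    by rewrite /= cats0 in Po.
  - rewrite mul0n /source insubF ?ltnn //=; split=> //=; rewrite ?addn0 // => x.
    by rewrite M0.
  - by lia.
have s_n : s < n by lia.
have srcE : source s = bfs_init (Ordinal s_n) by rewrite /source insubT.
add; add; const; const; bin; rewrite s_n /=; jz; add; store; store; add; const.
rewrite addn0.
apply: (slots_run _ _ _ _ (j := n) bk (ltnW s_n)) => //; last 1 first.
- move=> ptr1 d1 H1 T1 t11 t21 t31 k1 M1 g1 R1 M10 g1_le.
  have g1B := leq_trans g1_le (leq_add (slot_gap_le s n) (leqnn 2)).
  bin; rewrite ltn_eqF //=; jz; add; add; add; add; jmp; rewrite !addn0 addn1.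
  apply: (IHj s.+1) => //=.
  + by rewrite /banks; lia.
  + by lia.
  + move=> _ x x_n; case: R1 => Rlab _ _ _ _ _.
    by rewrite -(dst_label (Ordinal s_n) (Ordinal x_n)) -srcE -Rlab.
  (* Before pass [n], only pass 0 can end with a silent slot, when [n] is odd; hence the [E] in the
     bound for the next pass. *)
  + move: g1_le; rewrite /slot_gap; case: (n =P 0) => [n0|_]; first by lia.
    case: (n =P s) => [ns|_]; first by lia.
    case: (s =P 0) => [_|_] /=; last by lia.
    by case: (odd n) => /=; [rewrite mul1n; lia | lia].
  + by rewrite -catA.
- rewrite mul0n srcE; split=> //=; rewrite ?addn0 ?addn1 //.
    move=> x; have x_n := ltn_ord x.
    case: (cur + x =P n + n) => [|_]; first by lia.
    by rewrite eqn_add2l M0.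
  by case=> // _; rewrite addn0 eqxx.
- move=> s_gt0 x x_n /=; case: (prev + x =P n + n) => [|_]; first by lia.
  by case: (prev + x =P cur + s) => [|_]; [lia | rewrite Mdst].
- by lia.
Qed.

(** * Summation of the degrees *)

Definition sum_out v : seq triple :=
  [seq (x, x, Some 0) | x <- iota 0 v & ~~ odd x].

(** An even [v] outputs and leaves 2 steps of gap, an odd one adds 12. Erasing the first array
    accesses all addresses below [n], which gives the lower bound on the space. *)
Lemma sum_run j v acc t1 t2 t3 M g :
  v + j = n -> acc + \sum_(v <= x < n) rom (1 + x) = m ->
  (forall x, x < v -> M x = 0) ->
  g <= 14 - 12 * odd v ->
  P (sum_out n ++ flatten [seq pass_out x | x <- iota 0 n.+1]) ->
  reach 2 [:: 0; 1; n; acc; 0; 0; 0; 0; v; 0; 0; 0; 0; 0; t1; t2; t3] M g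
    (sum_out v) (iota v j).
Proof.
elim: j v acc t1 t2 t3 M g => [|j IHj] v acc t1 t2 t3 M g vj sum_acc M0 g_le Po;
  have g_le14 := leq_trans g_le (leq_subr _ _).
  have [r rE] : exists r, r = m %/ n by exists (m %/ n).
  have le_rm : r <= m by rewrite rE leq_div.
  rewrite addn0 in vj; rewrite {v}vj big_geq // addn0 in sum_acc M0 g_le *.
  bin; rewrite ltnn /=; jz; rewrite sum_acc.
  bin; rewrite -rE; add; add; add; add.
  rewrite addn0 rE -addnA.
  apply: (@passes_run n 0 0 n) => //; [by left | rewrite /=; lia].
have v_n : v < n by lia.
rewrite (big_ltn v_n) in sum_acc.
bin; rewrite v_n /=; jz; add; input; rewrite addnC; add.
store; rewrite eqxx; const; bin; rewrite modn2; jz.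
have Po' : sum_out v.+1 =
    sum_out v ++ (if odd v then [::] else [:: (v, v, Some 0)]).
  rewrite /sum_out -addn1 iotaD filter_cat map_cat /=.
  by case: odd.
have M0' x : x < v.+1 -> [eta M with v |-> 0] x = 0.
  rewrite ltnS leq_eqVlt => /predU1P[->|x_v] /=; first by rewrite eqxx.
  by case: eqP => // _; apply: M0.
have IH := IHj v.+1 (acc + rom (1 + v)).
case odd_v: (odd v) g_le Po' IH => /= g_le Po' IH.
  jmp; add; jmp; rewrite addn1 -[sum_out v]cats0 -Po'.
  by apply: IH => //=; rewrite ?odd_v /=; lia.
apply: reach_outdist; [reflexivity | lia | rewrite /=].
add; jmp; rewrite addn1 -cats1 -Po'.
by apply: IH => //=; rewrite ?odd_v /=; lia.
Qed.

Lemma prog_run M :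
  P (sum_out n ++ flatten [seq pass_out x | x <- iota 0 n.+1]) ->
  reach 0 (nseq 17 0) M 0 [::] (iota 0 n).
Proof.
move=> Po; const; input; rewrite rom_n.
apply: (@sum_run n 0 0 0 0 0 M 2) => //.
rewrite add0n big_mkord; apply: eq_bigr => u _; exact: rom_deg.
Qed.
End Machine.

(** * The enumeration *)

(** Serves to split the diagonal triple off the row of each source. *)
Lemma perm_flatten_cons (S T : eqType) (F G : S -> seq T) (a : S -> T) s :
  {in s, forall x, perm_eq (F x) (a x :: G x)} ->
  perm_eq (flatten (map F s)) (map a s ++ flatten (map G s)).
Proof.
elim: s => //= x s IHs Fs.
have {}IHs : perm_eq (flatten (map F s)) (map a s ++ flatten (map G s)).
  by apply: IHs => y ys; apply: Fs; rewrite inE ys orbT.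
have Fx := Fs x (mem_head _ _).
apply: (perm_trans (perm_cat Fx IHs)).
by rewrite /= perm_cons perm_catCA.
Qed.

Lemma flatten_if_map (S T : Type) (a : pred S) (f : S -> T) s :
  flatten [seq if a x then [:: f x] else [::] | x <- s] =
  [seq f x | x <- s & a x].
Proof. by elim: s => //= x s ->; case: (a x). Qed.

Definition nat_dist n (e : rel 'I_n) (u v : nat) : option nat :=
  if (insub u, insub v) is (Some u', Some v') then hop_dist e u' v' else None.

Lemma nat_distE n (e : rel 'I_n) (u v : 'I_n) : nat_dist e u v = hop_dist e u v.
Proof. by rewrite /nat_dist !valK. Qed.

Lemma hop_dist_refl (T : finType) (e : rel T) u : hop_dist e u u = Some 0.
Proof.
have walk0 : walk e 0 u u by apply/walkP; exists [::].
have := @hop_distP T e u u 1 (fun=> walk0) (fun _ _ => isT).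
by case: hop_dist => [[|k]|].
Qed.

Lemma apsd_iota n (e : rel 'I_n) :
  apsd e = [seq (u, v, nat_dist e u v) | u <- iota 0 n, v <- iota 0 n].
Proof.
rewrite /apsd -!val_enum_ord allpairs_mapl allpairs_mapr.
by apply: eq_allpairs => u v; rewrite nat_distE.
Qed.

(** The diagonal comes from the summation (even vertices) and pass 0 (odd vertices); pass [s.+1]
    outputs row [s] without its diagonal entry. *)
Lemma outputs_perm n (e : rel 'I_n) :
  perm_eq
    (sum_out n ++ flatten [seq pass_out n (nat_dist e) s | s <- iota 0 n.+1])
    (apsd e).
Proof.
rewrite apsd_iota /= -addn1 addnC iotaDl -map_comp catA.
have -> : flatten [seq (pass_out n (nat_dist e) \o addn 1) s | s <- iota 0 n] =
    flatten [seq [seq (s, v, nat_dist e s v) | v <- iota 0 n & v != s]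
            | s <- iota 0 n].
  congr flatten; apply: eq_map => s /=; rewrite -flatten_if_map.
  by congr flatten; apply: eq_map => v /=; case: eqP.
rewrite perm_sym; apply: perm_trans (perm_flatten_cons
    (a := fun s => (s, s, nat_dist e s s))
    (G := fun s => [seq (s, v, nat_dist e s v) | v <- iota 0 n & v != s]) _) _.
  move=> s s_n; set f := fun v => (s, v, nat_dist e s v).
  have -> : (s, s, nat_dist e s s) :: [seq f v | v <- iota 0 n & v != s] =
      map f ([seq v <- iota 0 n | v == s] ++ [seq v <- iota 0 n | v != s]).
    by rewrite (filter_pred1_uniq (iota_uniq 0 n) s_n).
  by apply: perm_map; rewrite perm_sym (perm_filterC (pred1 s)).
rewrite perm_cat2r /pass_out flatten_if_map /sum_out -map_cat.
have -> : [seq (s, s, nat_dist e s s) | s <- iota 0 n] =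
    [seq (s, s, Some 0) | s <- iota 0 n].
  apply/eq_in_map => s; rewrite mem_iota => s_n.
  by rewrite (nat_distE e (Ordinal s_n) (Ordinal s_n)) hop_dist_refl.
apply: perm_map; rewrite perm_sym perm_catC.
by rewrite (perm_filterC odd).
Qed.

(** The floor of m / n is at most the average degree, and the maximum with 1 absorbs the additive
    constant. *)
Lemma max_avg_outdeg_ge n (e : rel 'I_n) : 0 < n -> forall a b : nat,
  ((a * ((\sum_(u < n) #|e u|) %/ n) + b)%N%:R
     <= (a + b)%N%:R * Num.max 1 (avg_outdeg e) :> rat)%R.
Proof.
move=> n_gt0 a b; rewrite !natrD natrM mulrDl.
apply: lerD; last by rewrite ler_peMr // le_max lexx.
apply: ler_wpM2l => //; rewrite le_max; apply/orP; right.
by rewrite /avg_outdeg ler_pdivlMr ?ltr0n // -natrM ler_nat leq_divM.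
Qed.

Theorem theorem6 :
  exists (p : program) (c C : nat),
  forall (n w : nat) (e : rel 'I_n) (rom ram0 : nat -> nat),
    0 < n ->
    c * up_log 2 n.+1 <= w ->
    word_valued w rom ->
    word_valued w ram0 ->
    adjacency_lists w rom e ->
  exists T : nat,
    [/\ halted p (config_at w rom ram0 p T),
        perm_eq (outputs w rom ram0 p T) (apsd e),
        forall t : nat, t \in delays w rom ram0 p T ->
          (t%:R <= C%:R * Num.max 1 (avg_outdeg e))%R,
        space_used w rom ram0 p T <= C * n
      & n <= C * space_used w rom ram0 p T].
Proof.
exists prog, 5, 448 => n w e rom ram0 n_gt0 w_ge _ _ [rom_n].
case/fin_all_exists => adj adjP.
have adjE u v : (v \in adj u) = e u v by have [_ ->] := adjP u.
have sz_adj u : size (adj u) = #|e u|.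
  by have [/card_uniqP<- Eu _ _] := adjP u; apply: eq_card.
pose m := \sum_(u < n) size (adj u).
have le_mn : m <= n * n.
  rewrite -[X in _ <= X * _]card_ord -sum_nat_const; apply: leq_sum => u _.
  by rewrite sz_adj -[X in _ <= X]card_ord max_card.
(* As m is at most n ^ 2 and n is positive, the left side is below 8 (n + 1) ^ 2, hence below (n +
   1) ^ 5; this is the source of the factor 5 in the word size. *)
have small : 3 * n + m + 20 < 2 ^ w.
  apply: leq_trans (_ : n.+1 ^ 5 <= _); last first.
    apply: leq_trans (_ : 2 ^ (5 * up_log 2 n.+1) <= _);
      last by rewrite leq_exp2l.
    by rewrite mulnC expnM leq_exp2r // up_logP.
  suff : 2 ^ 3 * n.+1 ^ 2 <= n.+1 ^ 5 by nia.
  by rewrite (expnD _ 3 2) leq_mul2r leq_exp2r // ltnS n_gt0 orbT.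
(* The n slots of a pass offer n (m / n + 2) units, at least the n + m that a search takes. *)
have work_le : \sum_(u < n) (size (adj u)).+1 <= n * (m %/ n + 2).
  rewrite (eq_bigr (fun u => size (adj u) + 1)) => [|u _];
    last by rewrite addn1.
  rewrite big_split sum_nat_const card_ord /= -/m.
  by have := ltn_ceil m n_gt0; nia.
pose q := m %/ n + 2.
have run : reach w rom prog (4 * (14 * q + 20) + 200) (3 * n)
    (fun o => perm_eq o (apsd e)) 0 (nseq 17 0) ram0 0 [::] (iota 0 n).
  apply: (prog_run n_gt0 small rom_n _ _ (dst := nat_dist e)) => //.
  - by move=> u; have [] := adjP u.
  - by move=> u; have [] := adjP u.
  - by move=> s v; rewrite nat_distE; apply: bfs_final.
  - exact: outputs_perm.
have [T [hT oT dT aT nT]] := reach_terminates run.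
exists T; split; [exact: hT | exact: oT | | | ].
- move=> t /dT t_le.
  (* 4 (14 q + 20) + 200 = 56 (m / n) + 392, and 56 + 392 = 448. *)
  apply: le_trans (max_avg_outdeg_ge e n_gt0 56 392).
  rewrite ler_nat -(eq_bigr _ (fun u _ => sz_adj u)).
  by move: t_le; rewrite /q -/m; lia.
- apply: leq_trans (_ : 3 * n <= _); last by rewrite leq_mul2r orbT.
  rewrite -[3 * n](size_iota 0); apply: uniq_leq_size; first exact: undup_uniq.
  by move=> a; rewrite mem_undup => /aT; rewrite mem_iota.
- apply: leq_trans (_ : space_used w rom ram0 prog T <= _);
    last exact: leq_pmull.
  rewrite -{1}(size_iota 0 n); apply: uniq_leq_size; first exact: iota_uniq.
  by move=> a a_n; rewrite mem_undup nT.
Qed.
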